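(* Let $Y$ be a Banach space with the LD2P+ and let $X$ be a (closed) subspace of $Y$ which is an ai-ideal in $Y$. Then $X$ has the LD2P+.
   Context: Banach spaces are over the real scalars. $B_X$ and $S_X$ denote the closed unit ball and unit sphere of a Banach space $X$. For $x^*\in S_{X^*}$ and $\varepsilon>0$, $S(x^*,\varepsilon)=\{x\in B_X:x^*(x)>1-\varepsilon\}$. $X$ has the local diameter 2 property + (LD2P+) if for every $x^*\in S_{X^*}$, every $\varepsilon>0$, every $\delta>0$ and every $x\in S(x^*,\varepsilon)\cap S_X$ there exists $y\in S(x^*,\varepsilon)$ with $\|x-y\|>2-\delta$. A subspace $X$ of a Banach space $Y$ is an almost isometric ideal (ai-ideal) in $Y$ if for every $\varepsilon>0$ and every finite-dimensional subspace $E\subset Y$ there exists a linear operator $T:E\to X$ such that $Te=e$ for all $e\in X\cap E$ and $(1-\varepsilon)\|e\|\le\|Te\|\le(1+\varepsilon)\|e\|$ for all $e\in E$. *)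

(* Defs.v *)
From HB Require Import structures.
From mathcomp Require Import all_boot all_order all_algebra.
From mathcomp Require Import all_classical all_reals all_analysis.

Set Implicit Arguments.
Unset Strict Implicit.
Unset Printing Implicit Defensive.

Import Order.TTheory GRing.Theory Num.Theory.
Import numFieldNormedType.Exports.

Local Open Scope classical_set_scope.
Local Open Scope ring_scope.

(* A linear subspace, i.e. a [submodClosed] predicate, as a type with the
   vector space structure and the norm of the ambient space. *)
Record lsubspace (R : realType) (Y : normedModType R) (S : submodClosed Y) :=
  LSubspace { lsubspace_val :> Y ; lsubspaceP : lsubspace_val \in S }.

Section LSubspace.
Context (R : realType) (Y : normedModType R) (S : submodClosed Y).

HB.instance Definition _ := [isSub for @lsubspace_val R Y S].
HB.instance Definition _ := [Choice of lsubspace S by <:].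
HB.instance Definition _ := [SubChoice_isSubLmodule of lsubspace S by <:].

Let normS (x : lsubspace S) : R := `|val x|.

Let normS_triangle x y : normS (x + y) <= normS x + normS y.
Proof. by rewrite /normS raddfD ler_normD. Qed.

Let normS_scale (a : R) x : normS (a *: x) = `|a| * normS x.
Proof. by rewrite /normS linearZ normrZ. Qed.

Let normS_eq0 x : normS x = 0 -> x = 0.
Proof. by move=> /normr0_eq0 x0; apply: val_inj; rewrite x0 raddf0. Qed.

HB.instance Definition _ := Lmodule_isNormed.Build R (lsubspace S)
  normS_triangle normS_scale normS_eq0.

Lemma norm_lsubspaceE (x : lsubspace S) : `|x| = `|val x|.
Proof. by []. Qed.

End LSubspace.

Definition finite_dimensional (R : realType) (V : lmodType R) : Prop :=
  exists (n : nat) (b : 'I_n -> V), forall v : V,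
    exists a : 'I_n -> R, v = \sum_(i < n) a i *: b i.

Section LD2Pplus.
Context (R : realType) (V : normedModType R).

Definition unit_ball : set V := [set x | `|x| <= 1].

Definition unit_sphere : set V := [set x | `|x| = 1].

(* [sup] is 0 on sets without an upper bound, so this is the dual norm only
   for continuous [f]. *)
Definition dual_norm (f : {linear V -> R^o}) : R :=
  sup [set `|f x| | x in unit_ball].

Definition dual_sphere : set {linear V -> R^o} :=
  [set f : {linear V -> R^o} | continuous (f : V -> R^o) /\ dual_norm f = 1].

Definition slice (f : {linear V -> R^o}) (eps : R) : set V :=
  [set x | unit_ball x /\ f x > 1 - eps].

Definition LD2P_plus : Prop :=
  forall f : {linear V -> R^o}, dual_sphere f ->
  forall eps : R, 0 < eps ->
  forall delta : R, 0 < delta ->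
  forall x : V, (slice f eps `&` unit_sphere) x ->
  exists2 y : V, slice f eps y & `|x - y| > 2 - delta.

End LD2Pplus.

Definition ai_ideal (R : realType) (Y : normedModType R)
    (X : submodClosed Y) : Prop :=
  forall eps : R, 0 < eps ->
  forall E : submodClosed Y, finite_dimensional (lsubspace E) ->
  exists T : {linear lsubspace E -> lsubspace X},
    (forall e : lsubspace E, val e \in X -> val (T e) = val e) /\
    (forall e : lsubspace E,
       (1 - eps) * `|e| <= `|T e| /\ `|T e| <= (1 + eps) * `|e|).

(* Main.v *)
Require Import Defs.
From HB Require Import structures.
From mathcomp Require Import all_boot all_order all_algebra.
From mathcomp Require Import all_classical all_reals all_analysis.
From mathcomp Require Import lra.

Set Implicit Arguments.
Unset Strict Implicit.
Unset Printing Implicit Defensive.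

Import Order.TTheory GRing.Theory Num.Theory.
Import numFieldNormedType.Exports.

Local Open Scope classical_set_scope.
Local Open Scope ring_scope.

(** The point is to extend a given norm-one functional [f] on [X] to a
    norm-one functional [g] on [Y] that is compatible with the almost isometric
    operators: whenever [c < g y], there is such an operator [T], defined on
    a subspace containing [y] and any other prescribed vectors
    and as close to an isometry as desired, with [c < f (T y)].  An arbitrary
    Hahn-Banach extension need not have this property; the limit of the
    functionals [y |-> f (T y)] along an ultrafilter of maps [T : Y -> X] does
    ([ai_ideal_ultrafilter], [ai_ideal_extension]).  The ultrafilter contains,
    for every finite set of vectors and every tolerance, the set of maps that
    are linear and almost isometric on some subspace containing these vectors
    and fix the elements of [X] in it.
    Along it the values [f (T y)] are eventually bounded by
    [(1 + eta) * `|y|], so that the limits exist, are linear in [y], bounded by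
    [`|y|] and equal to [f] on [X]; hence [g] has dual norm 1.

    Given [x] of norm 1 in the slice of [f], the LD2P+ of [Y] applied to [g]
    and [x] yields [y] in the slice of [g] with [`|x - y|] almost 2.  For a
    suitable [T] with [T x = x], the vector [T y / (1 + eta)] is in the unit
    ball of [X], and differs by at most [eta] from [T y]; as
    [`|x - T y| >= (1 - eta) * `|x - y|], it is the required point for small
    [eta]. *)

(** * Finite linear combinations *)

(** The linear span of [s], as a predicate on [Y]; below it is a
    [submodClosed] predicate. *)
Definition lin_comb (R : realType) (Y : lmodType R) (s : seq Y) : {pred Y} :=
  fun y => `[< exists a : 'I_(size s) -> R,
                 y = \sum_(i < size s) a i *: tnth (in_tuple s) i >].

Section Span.
Context (R : realType) (Y : lmodType R) (s : seq Y).

Lemma lin_combP (y : Y) :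
  reflect (exists a : 'I_(size s) -> R,
             y = \sum_(i < size s) a i *: tnth (in_tuple s) i)
          (y \in lin_comb s).
Proof. exact: asboolP. Qed.

Lemma lin_comb_submod_closed : GRing.subsemimod_closed (lin_comb s).
Proof.
split; first split.
- apply/lin_combP; exists (fun=> 0).
  by rewrite big1 // => i _; rewrite scale0r.
- move=> _ _ /lin_combP[a ->] /lin_combP[b ->].
  apply/lin_combP; exists (fun i => a i + b i).
  by rewrite -big_split; apply: eq_bigr => i _; rewrite scalerDl.
- move=> k _ /lin_combP[a ->]; apply/lin_combP; exists (fun i => k * a i).
  by rewrite scaler_sumr; apply: eq_bigr => i _; rewrite scalerA.
Qed.

HB.instance Definition _ :=
  GRing.isSubmodClosed.Build R Y (lin_comb s) lin_comb_submod_closed.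

Lemma mem_lin_comb (y : Y) : y \in s -> y \in lin_comb s.
Proof.
move=> /(tnthP (in_tuple s))[i ->]; apply/lin_combP.
exists (fun j => (j == i)%:R).
rewrite (bigD1 i) //= eqxx scale1r big1 ?addr0 // => j /negPf ->.
by rewrite scale0r.
Qed.

End Span.

Lemma finite_dimensional_lin_comb (R : realType) (Y : normedModType R)
    (s : seq Y) :
  finite_dimensional (lsubspace (lin_comb s : submodClosed Y)).
Proof.
have memb i : tnth (in_tuple s) i \in lin_comb s.
  by apply: mem_lin_comb; exact: mem_tnth.
exists (size s), (fun i => LSubspace (memb i)) => v.
have /lin_combP[a va] := lsubspaceP v.
exists a; apply: val_inj; rewrite [LHS]va raddf_sum.
exact: eq_bigr.
Qed.

(** * The dual norm *)

Section DualNorm.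
Context (R : realType) (V : normedModType R).

Lemma dual_norm_has_ubound (f : {linear V -> R^o}) :
  continuous (f : V -> R^o) -> has_ubound [set `|f x| | x in @unit_ball R V].
Proof.
move=> /linear_bounded_continuous/linear_boundedP fb.
near (pinfty_nbhs R) => M.
have fM : forall x, `|f x| <= M * `|x| by near: M.
have M0 : 0 <= M by near: M; exact: nbhs_pinfty_ge.
exists M => _ [x x1 <-].
by apply: (le_trans (fM x)); exact: ler_piMr.
Unshelve. all: by end_near. Qed.

Lemma ler_dual_norm (f : {linear V -> R^o}) (x : V) :
  continuous (f : V -> R^o) -> `|f x| <= dual_norm f * `|x|.
Proof.
move=> cf; have [->|x0] := eqVneq x 0; first by rewrite linear0 !normr0 mulr0.
have nx : 0 < `|x| by rewrite normr_gt0.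
have : `|f (`|x|^-1 *: x)| <= dual_norm f.
  apply: (ub_le_sup (dual_norm_has_ubound cf)); exists (`|x|^-1 *: x) => //.
  by rewrite /unit_ball /= normrZ gtr0_norm ?invr_gt0// mulVf ?gt_eqF.
by rewrite linearZ normrZ gtr0_norm ?invr_gt0// mulrC ler_pdivrMr.
Qed.

End DualNorm.

(** * Limits along ultrafilters *)

Section UltraLimit.
Context (T : Type) (U : set_system T) {UU : UltraFilter U}.

Lemma fmap_ultra (S : Type) (h : T -> S) : UltraFilter (h @ U).
Proof.
split=> [|G GG UG]; first exact: fmap_proper_filter.
apply/seteqP; split=> // A GA.
have [//|UA] := in_ultra_setVsetC (h @^-1` A) UU.
have /filter_ex[z []//] : G (A `&` ~` A) by apply: filterI => //; exact: UG.
Qed.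

Lemma ultra_bounded_cvg (R : realType) (h : T -> R) (M : R) :
  (\forall t \near U, `|h t| <= M) -> exists l : R, h t @[t --> U] --> l.
Proof.
move=> hM.
have := @segment_compact R (- M) M; rewrite compact_ultra => /(_ (h @ U)).
case=> [||l [_ hl]]; first exact: fmap_ultra; last by exists l.
by apply: filterS hM => t; rewrite /= in_itv /= ler_norml.
Qed.

End UltraLimit.

(** * Extending functionals from almost isometric ideals *)

Section AiIdeal.
Context (R : realType) (Y : normedModType R) (X : submodClosed Y).

(** The map [T] behaves on the subspace [E] as the operators in the definition
    of an ai-ideal, with tolerance [eta].  It is a total map on [Y], so that
    operators with different domains live in a single type; outside [E] its
    values are irrelevant. *)
Definition almost_isometric_on (eta : R) (E : {pred Y})
    (T : Y -> lsubspace X) : Prop :=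
  [/\ forall a, {in E &, forall u v, T (a *: u + v) = a *: T u + T v},
      {in E, forall u, u \in X -> val (T u) = u} &
      {in E, forall u, (1 - eta) * `|u| <= `|T u| <= (1 + eta) * `|u|}].

(** The maps that are almost isometric, with tolerance at most [p.2], on some
    subspace containing the list [p.1].  Letting the subspace and the tolerance
    vary makes this set decrease when the list grows or the tolerance
    shrinks. *)
Definition local_maps (p : seq Y * R) : set (Y -> lsubspace X) :=
  [set T | exists2 E : submodClosed Y,
     {subset p.1 <= E} & exists2 eta, eta <= p.2 & almost_isometric_on eta E T].

Lemma local_maps_nonempty (s : seq Y) (eta : R) :
  ai_ideal X -> 0 < eta -> local_maps (s, eta) !=set0.
Proof.
move=> aiX eta0.
pose E := lin_comb s : submodClosed Y.
have [T [TX Tn]] := aiX _ eta0 E (finite_dimensional_lin_comb s).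
(* [insubd 0] is the identity on [E] and sends the rest of [Y] to 0. *)
exists (fun y => T (insubd 0 y)), E => /=.
  by move=> y; exact: mem_lin_comb.
exists eta => //; split.
- move=> a u v uE vE; rewrite -linearP; congr (T _); apply: val_inj.
  rewrite linearP /= !insubdK//.
  by apply: rpredD => //; apply: rpredZ.
- by move=> u uE uX; rewrite TX insubdK.
- move=> u uE; have [] := Tn (insubd 0 u).
  by rewrite norm_lsubspaceE insubdK// => -> ->.
Qed.

Lemma ai_ideal_ultrafilter : ai_ideal X ->
  exists U : set_system (Y -> lsubspace X),
    UltraFilter U /\ forall s eta, 0 < eta -> U (local_maps (s, eta)).
Proof.
move=> aiX.
have FF : ProperFilter (filter_from [set p | 0 < p.2] local_maps).
  apply: filter_from_proper; last by move=> [s eta]; exact: local_maps_nonempty.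
  apply: filter_from_filter; first by exists ([::], 1) => /=.
  move=> [s eta] [t theta] /= eta0 theta0.
  exists (s ++ t, Num.min eta theta); first by rewrite /= lt_min eta0.
  move=> T [E /= stE [e]]; rewrite le_min => /andP[ee et] TE.
  split; exists E => //=; try by exists e.
    by move=> y ys; apply: stE; rewrite mem_cat ys.
  by move=> y yt; apply: stE; rewrite mem_cat yt orbT.
have [U [UU FU]] := ultraFilterLemma FF.
exists U; split=> // s eta eta0; apply: FU.
by exists (s, eta).
Qed.

(** A norm-preserving extension [g] of [f], whose values at single vectors are
    approached by those of [f] at their images by almost isometric maps. *)
Lemma ai_ideal_extension (f : {linear lsubspace X -> R^o}) :
  ai_ideal X -> (forall x, `|f x| <= `|x|) ->
  exists g : {linear Y -> R^o},
    [/\ forall x : lsubspace X, g (val x) = f x,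
        forall y, `|g y| <= `|y| &
        forall (s : seq Y) y c eta, c < g y -> 0 < eta ->
          exists2 T, local_maps (y :: s, eta) T & c < f (T y)].
Proof.
move=> /ai_ideal_ultrafilter[U [UU UX]] f1.
have Ubound y eta : 0 < eta ->
    \forall T \near U, `|f (T y) : R| <= (1 + eta) * `|y|.
  move=> eta0; apply: filterS (UX [:: y] eta eta0).
  move=> T [E /= yE [e ee [_ _ Tn]]]; apply: (le_trans (f1 _)).
  have /andP[_ /le_trans] := Tn y (yE y (mem_head _ _)); apply.
  by rewrite ler_wpM2r// lerD2l.
have cvU y : exists l : R, (f (T y) : R) @[T --> U] --> l.
  exact: (ultra_bounded_cvg (Ubound y 1 ltr01)).
have [g gl] := choice cvU.
have glin : GRing.linear_for *:%R (g : Y -> R^o).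
  move=> a u v.
  have cv : (a * (f (T u) : R) + f (T v)) @[T --> U] --> a * g u + g v.
    by apply: cvgD; [apply: cvgMr|].
  apply: (cvg_unique (@Rhausdorff R) (gl _)).
  apply: cvg_trans cv; apply: near_eq_cvg.
  apply: filterS (UX [:: u; v] 1 ltr01).
  move=> T [E /= uvE [e _ [Tlin _ _]]].
  by rewrite Tlin ?linearP// uvE// !inE eqxx ?orbT.
pose gL : {linear Y -> R^o} :=
  HB.pack (g : Y -> R^o) (GRing.isLinear.Build R Y R^o *:%R g glin).
exists gL; split=> /=.
- move=> x; apply: (cvg_unique (@Rhausdorff R) (gl _)).
  apply: cvg_near_cst; apply: filterS (UX [:: val x] 1 ltr01).
  move=> T [E /= xE [e _ [_ TX _]]].
  suff -> : T (val x) = x by [].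
  apply: val_inj; apply: TX; last exact: lsubspaceP.
  exact: xE (mem_head _ _).
(* The tolerance [e / (1 + `|y|)] makes the error at [y] at most [e]. *)
- move=> y; apply/ler_addgt0Pr => e e0.
  have d0 : 0 < e / (1 + `|y|) by rewrite divr_gt0// ltr_pwDl.
  have : `|g y| <= (1 + e / (1 + `|y|)) * `|y|.
    have cv : `|f (T y) : R| @[T --> U] --> `|g y| by exact: cvg_norm.
    by apply: (cvgr_to_le cv); exact: Ubound.
  move=> /le_trans; apply; rewrite mulrDl mul1r lerD2l mulrAC -mulrA.
  rewrite ler_piMr ?(ltW e0)// ler_pdivrMr ?ltr_pwDl// mul1r.
  by rewrite lerDr.
- move=> s y c eta cgy eta0.
  have cU : \forall T \near U, c < (f (T y) : R) by exact: (cvgr_gt _ (gl y)).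
  have /filter_ex[T [TU cT]] : U (local_maps (y :: s, eta)
      `&` [set T | c < (f (T y) : R)]).
    by apply: filterI => //; exact: UX.
  by exists T.
Qed.

End AiIdeal.

Lemma dual_sphere_extension (R : realType) (Y : normedModType R)
    (X : submodClosed Y) (f : {linear lsubspace X -> R^o})
    (g : {linear Y -> R^o}) :
  dual_sphere f -> (forall x : lsubspace X, g (val x) = f x) ->
  (forall y, `|g y| <= `|y|) -> dual_sphere g.
Proof.
move=> [cf f1] gf g1.
have cg : continuous (g : Y -> R^o).
  apply/linear_bounded_continuous/linear_boundedP.
  near=> M.
  have M1 : 1 <= M by near: M; exact: nbhs_pinfty_ge.
  by move=> y; apply: (le_trans (g1 y)); exact: ler_peMl.
split=> //; apply/eqP; rewrite eq_le; apply/andP; split.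
  apply: ge_sup; first by exists `|g 0|, 0 => //; rewrite /unit_ball /= normr0.
  by move=> _ [y y1 <-]; exact: le_trans (g1 y) y1.
rewrite -f1; apply: ge_sup.
  by exists `|f 0|, 0 => //; rewrite /unit_ball /= normr0.
move=> _ [x x1 <-]; apply: (ub_le_sup (dual_norm_has_ubound cg)).
by exists (val x) => //; rewrite gf.
Unshelve. all: by end_near. Qed.

Theorem proposition3p8 (R : realType) (Y : completeNormedModType R)
    (X : submodClosed Y) :
  LD2P_plus Y ->
  closed [set y : Y | y \in X]%classic ->
  ai_ideal X ->
  LD2P_plus (lsubspace X).
Proof.
move=> YLD _ aiX f fS eps eps0 delta delta0 x [[x1 fx] xS].
have [cf nf] := fS.
have fle z : `|f z| <= `|z| by rewrite -[leRHS]mul1r -nf; exact: ler_dual_norm.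
have [g [gf g1 gT]] := ai_ideal_extension aiX fle.
have [|y [y1 gy] xy] := YLD g (dual_sphere_extension fS gf g1) eps eps0 delta
  delta0 (val x).
  by split => //; split => //; rewrite gf.
(* The strict inequalities [1 - eps < g y] and [2 - delta < `|x - y|] leave
   room for losing [eta] in the slice, and [(1 + `|x - y|) * eta <= 3 * eta] in
   the distance. *)
pose c : R := (1 - eps + g y) / 2.
pose eta : R := Num.min ((g y - (1 - eps)) / 2)
                        ((`|val x - y| - (2 - delta)) / 4).
have eta0 : 0 < eta by rewrite lt_min !divr_gt0// ?subr_gt0.
have cgy : c < g y by rewrite /c; move: gy; set u := g y : R; lra.
have ceta : 1 - eps + eta <= c.
  have : eta <= (g y - (1 - eps)) / 2 by rewrite ge_min lexx.
  by rewrite /c; set u := g y : R; lra.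
have etaxy : 4 * eta <= `|val x - y| - (2 - delta).
  have : eta <= (`|val x - y| - (2 - delta)) / 4 by rewrite ge_min lexx orbT.
  lra.
have [T [E /= yxE [e ee [Tlin TX Tn]]] cT] := gT [:: val x] y c eta cgy eta0.
have yE : y \in E by apply: yxE; rewrite mem_head.
have xE : val x \in E by apply: yxE; rewrite !inE eqxx orbT.
have TxE : T (val x) = x by apply: val_inj; exact: TX (lsubspaceP x).
have TyE : `|T y| <= 1 + eta.
  have /andP[_ /le_trans] := Tn y yE; apply.
  have y1' : `|y| <= 1 := y1.
  have := normr_ge0 y.
  nra.
(* [x - y] is in [E] and is mapped to [x - T y]. *)
have xTy : (1 - eta) * `|val x - y| <= `|x - T y|.
  have dE : - 1 *: y + val x \in E by apply: rpredD => //; apply: rpredZ.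
  have /andP[+ _] := Tn _ dE.
  rewrite Tlin// TxE !scaleN1r ![- _ + _]addrC.
  apply: le_trans; rewrite ler_wpM2r//; lra.
have xy2 : `|val x - y| <= 2.
  by apply: (le_trans (ler_normB _ _)); apply: lerD.
have e1 : 0 < 1 + eta by lra.
pose k := (1 + eta)^-1.
have k0 : 0 < k by rewrite invr_gt0.
have kE : k * (1 + eta) = 1 by rewrite mulVf ?gt_eqF.
have kTy : `|T y - k *: T y| <= eta.
  rewrite -{1}[T y]scale1r -scalerBl normrZ ger0_norm; last by nra.
  apply: (@le_trans _ _ ((1 - k) * (1 + eta))); last by nra.
  by apply: ler_wpM2l => //; nra.
exists (k *: T y).
  split.
    rewrite /unit_ball /= normrZ gtr0_norm// -[leRHS]kE.
    by apply: ler_wpM2l => //; exact: ltW.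
  have : `|f (T y) - f (k *: T y)| <= eta.
    by rewrite -linearB; exact: le_trans (fle _) kTy.
  rewrite ler_norml => /andP[_].
  move: cT; set u := f (T y) : R; set v := f (k *: T y) : R; lra.
have tri : `|x - T y| <= `|x - k *: T y| + `|T y - k *: T y|.
  rewrite -[x - T y](subrKA (k *: T y)).
  by rewrite [`|T y - _|]distrC; exact: ler_normD.
nra.
Qed.
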